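(* For $n\ge 1$, let $\mathrm{UFR}_n^{\uparrow}$ be the set of weakly increasing unit Fubini rankings of length $n$. Then $|\mathrm{UFR}_n^{\uparrow}|=F_{n+1}$, the $(n+1)$-th Fibonacci number, where $F_1=F_2=1$ and $F_{m+1}=F_m+F_{m-1}$.
   Context: $[n]=\{1,\ldots,n\}$. Parking process: $\alpha=(a_1,\ldots,a_n)\in[n]^n$ encodes preferences of cars $1,\ldots,n$ arriving in order at a one-way street with spots $1,\ldots,n$; car $i$ parks in spot $a_i$ if free, otherwise in the first free spot after $a_i$, if any. $\alpha$ is a parking function if all cars park. A unit interval parking function is a parking function in which each car $i$ parks in spot $a_i$ or $a_i+1$. A Fubini ranking is a tuple $(r_1,\ldots,r_n)\in[n]^n$ with $r_i=1+|\{j:r_j<r_i\}|$ for all $i$. A unit Fubini ranking is a tuple that is both a Fubini ranking and a unit interval parking function. *)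

(* Defs.v *)
From mathcomp Require Import all_boot.

Set Implicit Arguments.
Unset Strict Implicit.
Unset Printing Implicit Defensive.

(* The ordinal k : 'I_n stands for the element k + 1 of [n] = {1, ..., n}, so
   a tuple in [n]^n is an n.-tuple 'I_n, with cars and spots counted from 0. *)

(* [enum 'I_n] is increasing, so this is the first free spot at or after [a]. *)
Definition first_free (n : nat) (occ : {set 'I_n}) (a : 'I_n) : option 'I_n :=
  ohead [seq s : 'I_n <- enum 'I_n | (a <= s) && (s \notin occ)].

(* The i-th entry is the spot taken by the i-th car, or None if that car leaves
   the street without parking; [occ] is the set of spots already occupied. *)
Fixpoint park (n : nat) (occ : {set 'I_n}) (prefs : seq 'I_n) :
    seq (option 'I_n) :=
  if prefs is a :: prefs' then
    let s := first_free occ a in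
    s :: park (if s is Some t then t |: occ else occ) prefs'
  else [::].

Definition spot (n : nat) (alpha : n.-tuple 'I_n) (i : 'I_n) : option 'I_n :=
  nth None (park set0 alpha) i.

Definition parking_function (n : nat) (alpha : n.-tuple 'I_n) : bool :=
  [forall i : 'I_n, isSome (spot alpha i)].

Definition unit_interval_parking_function (n : nat) (alpha : n.-tuple 'I_n) :
    bool :=
  parking_function alpha &&
  [forall i : 'I_n, if spot alpha i is Some s then
     (s == tnth alpha i :> nat) || (s == (tnth alpha i).+1 :> nat) else false].

(* The successor on the left converts the ordinal to its value in {1, ..., n}. *)
Definition fubini_ranking (n : nat) (r : n.-tuple 'I_n) : bool :=
  [forall i : 'I_n,
     (tnth r i).+1 == 1 + #|[set j : 'I_n | tnth r j < tnth r i]|].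

Definition unit_fubini_ranking (n : nat) (r : n.-tuple 'I_n) : bool :=
  fubini_ranking r && unit_interval_parking_function r.

Definition weakly_increasing (n : nat) (r : n.-tuple 'I_n) : bool :=
  [forall i : 'I_n, forall j : 'I_n, (i <= j) ==> (tnth r i <= tnth r j)].

Definition UFR_up (n : nat) : {set n.-tuple 'I_n} :=
  [set r : n.-tuple 'I_n | unit_fubini_ranking r && weakly_increasing r].

Fixpoint fib (m : nat) : nat :=
  match m with
  | 0 => 0
  | 1 => 1
  | (m'.+1 as m1).+1 => fib m1 + fib m'
  end.

(* Main.v *)
Require Import Defs.
From mathcomp Require Import all_boot zify.

(** In a weakly increasing Fubini ranking the i-th entry (from 0) is at most i,
    so cars fill the street from left to right and car i parks in spot i.  The
    unit interval condition then says r_i = i or r_i = i - 1, and the Fubini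
    condition says that r_i = i - 1 forces r_(i-1) = i - 1.  Hence the ranking
    splits into blocks of one or two equal entries, i.e. it is a composition of
    n into parts 1 and 2, and these are counted by F_(n+1). *)

Set Implicit Arguments.
Unset Strict Implicit.
Unset Printing Implicit Defensive.

(* The argument [k] is the number of entries preceding the sequence. *)
Fixpoint block_rankings (n k : nat) : seq (seq nat) :=
  match n with
  | 0 => [:: [::]]
  | 1 => [:: [:: k]]
  | (n'.+1 as n1).+1 =>
      [seq k :: s | s <- block_rankings n1 k.+1] ++
      [seq k :: k :: s | s <- block_rankings n' k.+2]
  end.

(** The left alternative lets position i open a block, the right one lets it close a block of two
    opened at j. Writing i as [j.+1] avoids a truncated predecessor. *)
Definition block_condition (k : nat) (s : seq nat) : Prop :=
  forall i, i < size s -> nth 0 s i = k + i \/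
    exists2 j, i = j.+1 & nth 0 s i = k + j /\ nth 0 s j = k + j.

Lemma nat_ind2 (P : nat -> Prop) :
  P 0 -> P 1 -> (forall n, P n -> P n.+1 -> P n.+2) -> forall n, P n.
Proof.
move=> P0 P1 PS n; suff [] : P n /\ P n.+1 by [].
by elim: n => [|n [Pn Pn1]]; split => //; apply: PS.
Qed.

Lemma size_block_rankings n k : size (block_rankings n k) = fib n.+1.
Proof.
elim/nat_ind2: n k => // n IHn IHn1 k.
change (size ([seq k :: s | s <- block_rankings n.+1 k.+1] ++
  [seq k :: k :: s | s <- block_rankings n k.+2]) = fib n.+2 + fib n.+1).
by rewrite size_cat !size_map IHn IHn1.
Qed.

Lemma block_condition_cons1 k s :
  block_condition k.+1 s -> block_condition k (k :: s).
Proof.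
move=> Hs [|i] /= Hi; first by left; lia.
have [Ei|[j -> [E1 E2]]] := Hs i Hi; first by left; lia.
by right; exists j.+1 => //=; lia.
Qed.

Lemma block_condition_cons2 k s :
  block_condition k.+2 s -> block_condition k (k :: k :: s).
Proof.
move=> Hs [|[|i]] /= Hi; first by left; lia.
  by right; exists 0 => //=; lia.
have [Ei|[j -> [E1 E2]]] := Hs i Hi; first by left; lia.
by right; exists j.+2 => //=; lia.
Qed.

Lemma block_condition_inv k a b t : block_condition k [:: a, b & t] ->
  a = k /\ (block_condition k.+1 (b :: t) \/ b = k /\ block_condition k.+2 t).
Proof.
move=> Hs; have Ea : a = k by case: (Hs 0 isT) => [|[]] //=; lia.
split=> //; have [/= Eb|[_ [<-] /= [Eb _]]] := Hs 1 isT.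
  left=> i Hi; have [/= Ei|[_ [<-] /= [E1 E2]]] := Hs i.+1 Hi; first by left; lia.
  (* No block of two straddles the cut: at i = 0 it would force b = k, but here b = k + 1. *)
  by case: i Hi E1 E2 => [|i] /= Hi E1 E2; [lia | right; exists i; lia].
right; split=> [|i Hi]; first lia.
have [/= Ei|[_ [<-] /= [E1 E2]]] := Hs i.+2 Hi; first by left; lia.
(* Here a straddling block would force b = k + 1, against b = k. *)
by case: i Hi E1 E2 => [|i] /= Hi E1 E2; [lia | right; exists i; lia].
Qed.

Lemma block_rankingsP n k s :
  s \in block_rankings n k <-> size s = n /\ block_condition k s.
Proof.
elim/nat_ind2: n k s => [|| n IHn IHn1] k s.
- rewrite inE; split=> [/eqP -> //|[]].
  by case: s.
- rewrite inE; split=> [/eqP ->|[]].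
    by split=> // -[|i] //= _; left; lia.
  case: s => [|a [|b t]] //= _ Hs; apply/eqP; congr (_ :: _).
  by case: (Hs 0 isT) => [|[]] //=; lia.
change (s \in [seq k :: t | t <- block_rankings n.+1 k.+1] ++
  [seq k :: k :: t | t <- block_rankings n k.+2] <->
  size s = n.+2 /\ block_condition k s).
rewrite mem_cat; split.
  case/orP=> /mapP[t].
    by move=> /IHn1[Et Ht] ->; split; [rewrite /= Et | apply: block_condition_cons1].
  by move=> /IHn[Et Ht] ->; split; [rewrite /= Et | apply: block_condition_cons2].
case: s => [|a [|b t]] //= -[] // [Et] /block_condition_inv[-> [Hs|[-> Hs]]].
  by rewrite map_f //; apply/IHn1; rewrite /= Et.
by rewrite orbC map_f //; apply/IHn.
Qed.

Lemma block_rankings_uniq n k : uniq (block_rankings n k).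
Proof.
elim/nat_ind2: n k => // n IHn IHn1 k.
change (uniq ([seq k :: s | s <- block_rankings n.+1 k.+1] ++
  [seq k :: k :: s | s <- block_rankings n k.+2])).
rewrite cat_uniq !map_inj_uniq ?IHn ?IHn1 ?andbT => [|s t []|s t []] //.
(* The two families are disjoint: the second entry is k after a block of two and k + 1 after a
   singleton. *)
apply/hasPn=> _ /mapP[s _ ->]; apply/negP=> /mapP[t /block_rankingsP[_ Ht] [Et]].
by move: Ht; rewrite -Et => /(_ 0 isT) [|[]] //=; lia.
Qed.

Lemma card_ord_ltn n m : m <= n -> #|[set j : 'I_n | j < m]| = m.
Proof.
move=> le_mn; rewrite -sum1_card -[RHS]card_ord -[RHS]sum1_card.
rewrite (big_ord_widen n (fun _ => 1) le_mn).
by apply: eq_bigl => j; rewrite inE.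
Qed.

(** The filtered enumeration is strictly increasing, so a head other than [s] would be a free spot
    in [a, s). *)
Lemma first_freeE n (occ : {set 'I_n}) (a s : 'I_n) :
  a <= s -> s \notin occ -> (forall t : 'I_n, a <= t < s -> t \in occ) ->
  first_free occ a = Some s.
Proof.
move=> le_as s_free s_first; rewrite /first_free.
set q := fun t : 'I_n => _.
have srt : sorted (relpre val ltn) (filter q (enum 'I_n)).
  apply: sorted_filter; first by move=> y x z /=; apply: ltn_trans.
  by rewrite -sorted_map val_enum_ord iota_ltn_sorted.
have: s \in filter q (enum 'I_n) by rewrite mem_filter mem_enum /q le_as s_free.
have: all q (filter q (enum 'I_n)) by apply: filter_all.
case: (filter q _) srt => [|h t] //= srt /andP[/andP[le_ah h_free] _].
rewrite inE => /predU1P[-> //|s_t].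
have := order_path_min _ srt => /(_ _)/allP/(_ s s_t) => /= lt_hs.
have {}lt_hs : h < s by apply: lt_hs => y x z /=; apply: ltn_trans.
by rewrite s_first ?le_ah in h_free.
Qed.

(** Induction with the invariant that the occupied spots are the first m: the next car prefers a
    spot at most m, lands in m, and the segment grows by one. The default of [nth] is quantified
    because ['I_n] may be empty. *)
Lemma nth_park_prefix n (p : seq 'I_n) m :
  m + size p <= n ->
  (forall i (a : 'I_n), i < size p -> nth a p i <= m + i) ->
  forall i (s : 'I_n), i < size p -> s = m + i :> nat ->
  nth None (park [set j : 'I_n | j < m] p) i = Some s.
Proof.
elim: p m => [|a p IHp] m //= Hm Hp i s Hi Es.
have lt_mn : m < n by lia.
have le_am : a <= m by have := Hp 0 a isT; rewrite addn0.
have -> : first_free [set j : 'I_n | j < m] a = Some (Ordinal lt_mn).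
  apply: first_freeE; rewrite ?inE ?ltnn //= => t.
  by rewrite inE => /andP[].
case: i Hi Es => [|i] Hi Es /=; first by congr Some; apply: val_inj; rewrite /= Es addn0.
have -> : Ordinal lt_mn |: [set j : 'I_n | j < m] = [set j : 'I_n | j < m.+1].
  by apply/setP=> j; rewrite !inE -val_eqE /=; lia.
apply: IHp => //; try lia.
by move=> i' b Hi'; have := Hp i'.+1 b Hi'; rewrite /= addnS.
Qed.

Lemma spot_diag n (r : n.-tuple 'I_n) :
  (forall i : 'I_n, tnth r i <= i) -> forall i, spot r i = Some i.
Proof.
move=> Hr i; rewrite /spot.
have -> : set0 = [set j : 'I_n | j < 0] by apply/setP=> j; rewrite !inE.
apply: nth_park_prefix; rewrite ?size_tuple //.
by move=> k a Hk; have := Hr (Ordinal Hk); rewrite (tnth_nth a).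
Qed.

Lemma unit_interval_diag n (r : n.-tuple 'I_n) :
  (forall i : 'I_n, tnth r i <= i) ->
  unit_interval_parking_function r =
  [forall i : 'I_n, (i == tnth r i :> nat) || (i == (tnth r i).+1 :> nat)].
Proof.
move=> Hr; rewrite /unit_interval_parking_function /parking_function.
have -> : [forall i, isSome (spot r i)].
  by apply/forallP=> i; rewrite spot_diag.
by apply: eq_forallb => i; rewrite spot_diag.
Qed.

(** By monotonicity, entries strictly below r_i sit at positions before i, so there are at most i of
    them. *)
Lemma fubini_increasing_le n (r : n.-tuple 'I_n) :
  fubini_ranking r -> weakly_increasing r -> forall i : 'I_n, tnth r i <= i.
Proof.
move=> /forallP Hf /forallP Hw i.
have /eqP[->] := Hf i; rewrite -[leqRHS](@card_ord_ltn n) ?(ltnW (ltn_ord i)) //.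
apply/subset_leq_card/subsetP=> j; rewrite !inE.
have /forallP/(_ j)/implyP := Hw i.
by case: (ltnP j i) => // le_ij /(_ isT); rewrite leqNgt => /negP.
Qed.

Lemma UFR_upP n (r : n.-tuple 'I_n) :
  r \in UFR_up n <-> block_condition 0 (map val r).
Proof.
have nthE (i : 'I_n) : nth 0 (map val r) i = tnth r i.
  by rewrite (nth_map i) ?size_tuple // (tnth_nth i).
rewrite inE; split.
  case/andP=> /andP[Hf Hu] Hw; have Hr := fubini_increasing_le Hf Hw.
  move: Hu; rewrite unit_interval_diag // => /forallP Hu.
  move=> i; rewrite size_map size_tuple => lt_in.
  rewrite (nthE (Ordinal lt_in)) add0n.
  have /orP[/eqP<-|/eqP/= Ei] := Hu (Ordinal lt_in); first by left.
  right; case: i lt_in Ei => // j lt_jn [Ej]; exists j => //.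
  have lt_jn' : j < n by lia.
  rewrite (nthE (Ordinal lt_jn')) add0n -Ej; split=> //.
  have /orP[/eqP /= <-|/eqP/= Ej'] := Hu (Ordinal lt_jn'); first by [].
  have /forallP/(_ (Ordinal lt_jn))/eqP[] := Hf.
  rewrite -Ej => Ecard.
  (* If r_j = j - 1, then by monotonicity all positions 0, ..., j carry entries below r_(j+1) = j,
     whereas the Fubini condition counts only j such entries. *)
  suff: j.+1 <= j by rewrite ltnn.
  rewrite [leqRHS]Ecard -[leqLHS](@card_ord_ltn n) ?(ltnW lt_jn) //.
  apply/subset_leq_card/subsetP=> l; rewrite !inE ltnS => le_lj.
  move/forallP/(_ l)/forallP/(_ (Ordinal lt_jn'))/implyP: Hw => /(_ le_lj) /=; lia.
move=> Hb.
have Hr (i : 'I_n) : tnth r i = i :> nat \/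
    exists2 j : 'I_n, i = j.+1 :> nat & tnth r i = j :> nat /\ tnth r j = j :> nat.
  have := Hb i; rewrite size_map size_tuple => /(_ (ltn_ord i)).
  rewrite nthE !add0n => -[|[j Ej [E1 E2]]]; [by left | right].
  have lt_jn : j < n by have := ltn_ord i; lia.
  by exists (Ordinal lt_jn) => //; split=> //; rewrite -nthE.
have r_le (i : 'I_n) : tnth r i <= i by case: (Hr i) => [|[j]]; lia.
have r_ge (i : 'I_n) : i <= (tnth r i).+1 by case: (Hr i) => [|[j]]; lia.
have r_mono (i j : 'I_n) : i <= j -> tnth r i <= tnth r j.
  rewrite leq_eqVlt => /orP[/eqP/val_inj -> //|].
  (* For i < j: r_i <= i <= j - 1 <= r_j. *)
  by have := r_le i; have := r_ge j; lia.
apply/andP; split; last by apply/forallP=> i; apply/forallP=> j; apply/implyP/r_mono.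
apply/andP; split.
  apply/forallP=> i; rewrite add1n eqSS.
  (* The entries below r_i are exactly those at positions before r_i, because position r_i opens the
     block of i and so holds the value r_i itself. *)
  rewrite -[X in X == _](@card_ord_ltn n) ?(ltnW (ltn_ord _)) //.
  apply/eqP/eq_card => j; rewrite !inE.
  apply/idP/idP=> [|]; first exact: leq_ltn_trans.
  rewrite !ltnNge; apply: contra => le_rij.
  case: (Hr i) => [Ei|[l El [E1 E2]]]; first by apply: r_mono; rewrite -Ei.
  by rewrite E1 -[leqLHS]E2; apply: r_mono; rewrite -E1.
rewrite unit_interval_diag //; apply/forallP=> i.
by have := r_le i; have := r_ge i; lia.
Qed.

Theorem theorem3p8 (n : nat) (hn : 1 <= n) : #|UFR_up n| = fib n.+1.
Proof.
rewrite -(size_block_rankings n 0) cardE.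
(* Forgetting the bounds is injective, so it suffices that the image and [block_rankings n 0] are
   duplicate-free with the same members. *)
rewrite -(size_map (fun r : n.-tuple 'I_n => map val r)).
apply/perm_size/uniq_perm; last 1 first.
- move=> s; apply/mapP/idP=> [[r] | /block_rankingsP[Es Hs]].
    rewrite mem_enum => /UFR_upP Hr ->; apply/block_rankingsP.
    by rewrite size_map size_tuple.
  have s_lt x : x \in s -> x < n.
    move=> /(nthP 0)[i Hi <-].
    rewrite -Es; case: (Hs i Hi) => [->|[j Ej [-> _]]]; first by [].
    by apply: leq_trans Hi; rewrite Ej.
  (* [hn] only provides the default of [insubd], which is never returned since all entries are below
     n. *)
  have size_t : size (map (insubd (Ordinal hn)) s) == n by rewrite size_map Es.
  have Et : s = map val (Tuple size_t).
    rewrite /= -map_comp -[LHS]map_id; apply/eq_in_map=> x /s_lt lt_xn /=.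
    by rewrite val_insubd lt_xn.
  by exists (Tuple size_t) => //; rewrite mem_enum; apply/UFR_upP; rewrite -Et.
- rewrite map_inj_uniq; first exact: enum_uniq.
  by move=> r1 r2 /(inj_map val_inj)/val_inj.
- exact: block_rankings_uniq.
Qed.
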